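(* Let $\boldsymbol\varphi=(\varphi_1,\varphi_2)\in\{0,1\}^2$ be given and let $D>0$. (A) Subgames of type $S_1S_0$ and type $S_0S_0$ (i.e., when $\varphi_1+\varphi_2<2$): - If $D\ge\sum_i y_i^*(\bar p,\varphi_i)$, there exists a pure price equilibrium $p_i^*=\bar p$, with equilibrium revenue $\pi_i^{RE}=\lambda\int_0^{F_i^{-1}(\bar p/\lambda)}x f_i(x)\,dx$, for any $i=1,2$. - If $0<D<\sum_i y_i^*(\bar p,\varphi_i)$, there is no pure price equilibrium. (B) Subgame of type $S_1S_1$ (i.e., when $\varphi_1+\varphi_2=2$): - If $D\ge\sum_i y_i^*(\bar p,\varphi_i)$, there exists a pure price equilibrium $p_i^*=\bar p$, with equilibrium revenue $\pi_i^{RE}=\bar p\,\mathbb E[X_i]$, for any $i=1,2$. - If $D\le\min_i y_i^*(\bar p,\varphi_i)$, there exists a pure price equilibrium $p_i^*=0$, with equilibrium revenue $\pi_i^{RE}=0$, for any $i=1,2$. - If $\min_i y_i^*(\bar p,\varphi_i)<D<\sum_i y_i^*(\bar p,\varphi_i)$, there is no pure price equilibrium.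
   Context: There are two suppliers $i\in\{1,2\}$; $-i$ denotes the other supplier. Constants: demand $D>0$, price cap $\bar p>0$, penalty price $\lambda>\bar p$. Supplier $i$'s renewable generation is a random variable $X_i$ bounded in $[0,\bar X_i]$ with continuous CDF $F_i$ and density $f_i$; $F_i^{-1}$ denotes the inverse function of $F_i$, with $F_i^{-1}(0)=0$. $\varphi_i=1$ means supplier $i$ invests in storage, $\varphi_i=0$ that he does not. Each supplier bids a price $p_i\in[0,\bar p]$; his bidding quantity is $y_i^*(p_i,\varphi_i)=\mathbb E[X_i]$ if $\varphi_i=1$ and $y_i^*(p_i,\varphi_i)=F_i^{-1}(p_i/\lambda)$ if $\varphi_i=0$; write $\boldsymbol y^*(\boldsymbol p,\boldsymbol\varphi)$ for the pair. Consumers' purchase: if $p_i<p_{-i}$, then $x_i^*(\boldsymbol p,\boldsymbol y)=\min(D,y_i)$ and $x_{-i}^*(\boldsymbol p,\boldsymbol y)=\min(D-\min(D,y_i),\,y_{-i})$. If $p_1=p_2$, the demand is allocated according to the rule for either $p_1<p_2$ or $p_2<p_1$, the choice being made so as to maximize the two suppliers' total revenue (with equal probabilities if there is no difference). Revenue, with $(g)^+=\max(g,0)$: $\pi_i^R(p_i,x,\boldsymbol\varphi)=p_ix-\lambda(x-\mathbb E[X_i])^+$ if $\varphi_i=1$, and $\pi_i^R(p_i,x,\boldsymbol\varphi)=p_ix-\lambda\mathbb E[(x-X_i)^+]$ if $\varphi_i=0$. A pure price equilibrium is a vector $\boldsymbol p^*\in[0,\bar p]^2$ such that for both $i$ and all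 $p_i\in[0,\bar p]$, $\pi_i^R(p_i^*,x_i^*(\boldsymbol p^*,\boldsymbol y^*(\boldsymbol p^*,\boldsymbol\varphi)),\boldsymbol\varphi)\ge\pi_i^R(p_i,x_i^*((p_i,p_{-i}^* ),\boldsymbol y^*((p_i,p_{-i}^* ),\boldsymbol\varphi)),\boldsymbol\varphi)$. The left-hand side is the equilibrium revenue $\pi_i^{RE}$.
   Formalization: In (A), first bullet, the integral formula for the equilibrium revenue is false for a supplier with storage (X_i uniform on [0,1] gives p̄²/(2λ) < p̄/2); for φ_i=1 in S1S0 the formal statement gives p̄ E[X_i] instead, and keeps the integral formula for φ_i=0. *)

(* Defs.v *)
From HB Require Import structures.
From mathcomp Require Import all_boot all_order all_algebra.
From mathcomp Require Import all_classical all_reals all_analysis.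

Set Implicit Arguments.
Unset Strict Implicit.
Unset Printing Implicit Defensive.

Import Order.TTheory GRing.Theory Num.Theory.
Import numFieldNormedType.Exports.

Local Open Scope classical_set_scope.
Local Open Scope ring_scope.

Definition other (i : 'I_2) : 'I_2 := rev_ord i.

(* The price vector (q, p_{-i}). *)
Definition deviate (R : realType) (p : 'I_2 -> R) (i : 'I_2) (q : R) :
    'I_2 -> R :=
  fun j => if j == i then q else p j.

Definition has_density (R : realType) (d : measure_display)
    (T : measurableType d) (P : probability T R) (X : {RV P >-> R})
    (f : R -> R) : Prop :=
  [/\ measurable_fun setT f,
      forall x, 0 <= f x &
      forall A : set R, measurable A ->
        distribution P X A = (\int[lebesgue_measure]_(x in A) (f x)%:E)%E].

(* The CDF vanishes on ]-oo, 0] and equals 1 to the right of the support, so it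
   can be invertible only over the levels q in ]0, 1[; there, Finv q is the
   unique point of level q. The value at 0 is a convention (it matters when
   the support starts to the right of 0). *)
Definition is_inverse_cdf (R : realType) (d : measure_display)
    (T : measurableType d) (P : probability T R) (X : {RV P >-> R})
    (Finv : R -> R) : Prop :=
  Finv 0 = 0 /\
  forall q x : R, 0 < q < 1 -> (cdf X x = q%:E <-> x = Finv q).

Section market.
Variables (R : realType) (d : measure_display) (T : measurableType d).
Variable P : probability T R.
Variables D pbar lambda : R.
Variable X : 'I_2 -> {RV P >-> R}.
Variable Finv : 'I_2 -> R -> R.
Variable phi : 'I_2 -> bool.

Definition mean (i : 'I_2) : R := fine ('E_P[X i])%E.

Definition bid_quantity (p : 'I_2 -> R) (i : 'I_2) : R :=
  if phi i then mean i else Finv i (p i / lambda).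

(* Purchase from supplier i when supplier k is served first. *)
Definition alloc (y : 'I_2 -> R) (k i : 'I_2) : R :=
  if i == k then Num.min D (y k)
  else Num.min (D - Num.min D (y k)) (y i).

Definition sale_revenue (i : 'I_2) (q x : R) : R :=
  if phi i then q * x - lambda * Num.max (x - mean i) 0
  else q * x -
       lambda * fine ('E_P[fun t => (Num.max (x - X i t) 0)%R])%E.

Definition total_revenue (p y : 'I_2 -> R) (k : 'I_2) : R :=
  \sum_(i < 2) sale_revenue i (p i) (alloc y k i).

(* Probability that supplier k is served first. *)
Definition prob_first (p y : 'I_2 -> R) (k : 'I_2) : R :=
  if p k < p (other k) then 1
  else if p (other k) < p k then 0
  else if total_revenue p y (other k) < total_revenue p y k then 1
  else if total_revenue p y k < total_revenue p y (other k) then 0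
  else 2^-1.

(* The allocation is random only when prices tie and both orders give the same
   total revenue; the revenue is then the expectation over the coin flip (of
   the revenues, not the revenue of the mean allocation). *)
Definition revenue (p y : 'I_2 -> R) (i : 'I_2) : R :=
  \sum_(k < 2) prob_first p y k * sale_revenue i (p i) (alloc y k i).

Definition subgame_revenue (p : 'I_2 -> R) (i : 'I_2) : R :=
  revenue p (bid_quantity p) i.

Definition pure_price_equilibrium (p : 'I_2 -> R) : Prop :=
  (forall i, 0 <= p i <= pbar) /\
  (forall i (q : R), 0 <= q <= pbar ->
     subgame_revenue (deviate p i q) i <= subgame_revenue p i).

End market.

(* Main.v *)
Require Import Defs.
From HB Require Import structures.
From mathcomp Require Import all_boot all_order all_algebra.
From mathcomp Require Import all_classical all_reals all_analysis.
From mathcomp Require Import measurable_realfun ring lra.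

Set Implicit Arguments.
Unset Strict Implicit.
Unset Printing Implicit Defensive.

Import Order.TTheory GRing.Theory Num.Theory.
Import numFieldNormedType.Exports.
Local Open Scope classical_set_scope.
Local Open Scope ring_scope.

(* At any price q in ]0, pbar], the revenue q x - c(x) of a supplier (c being
   his expected penalty) is strictly increasing in the quantity x sold up to
   the bid y(q), and maximal there; moreover y(q) > 0. All the cases follow
   from these three facts. If the prices differ, the cheaper supplier gains by
   raising his price while remaining the cheaper one. If they agree at q > 0
   and D < y_1(q) + y_2(q), a supplier who is not always served first gains by
   a small undercut; if D >= y_1(q) + y_2(q) and q < pbar, raising the price
   costs no sales. At the common price 0, raising the price is profitable as
   soon as the other supplier's bid leaves a residual demand.
   The value of the revenue at the cap comes from
   x F(x) - E[(x - X)^+] = E[X; X <= x], taken at F(x) = pbar / lambda. *)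

(** * Integration against the law of a random variable with a density *)

Section density.
Context {R : realType} {d : measure_display} {T : measurableType d}.
Context {P : probability T R} {X : {RV P >-> R}} {f : R -> R}.
Hypothesis Xf : has_density X f.

Lemma density_set1 x : distribution P X [set x] = 0%E.
Proof.
by case: Xf => mf f0 fE; rewrite fE// integral_set1.
Qed.

(** Having a density makes the law absolutely continuous, so the Radon-Nikodym change of variables
    applies. The Radon-Nikodym derivative [g] and [f] agree almost everywhere because they have the
    same integral over every measurable set. *)
Lemma density_change_of_variables (h : R -> \bar R) :
  (forall x, 0 <= h x)%E -> measurable_fun setT h ->
  (\int[lebesgue_measure]_x (h x * (f x)%:E) = \int[P]_t h (X t))%E.
Proof.
move=> h0 mh; case: (Xf) => mf f0 fE.
(* lebesgue_measure lives on measurableTypeR R, whose display is not that of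
   R: X has to be recast before its law can be compared with it. *)
have mX : @measurable_fun _ _ T (measurableTypeR R) setT X.
  exact: (measurable_funPT X).
pose X' : {RV P >-> measurableTypeR R} :=
  HB.pack (X : T -> measurableTypeR R) (isMeasurableFun.Build _ _ _ _ _ mX).
have X'E A : measurable A ->
    distribution P X' A = (\int[lebesgue_measure]_(x in A) (f x)%:E)%E.
  by move=> mA; rewrite -fE.
have X'leb : distribution P X' `<< (@lebesgue_measure R).
  apply/null_content_dominatesP => A mA A0.
  by rewrite X'E// null_set_integral//; exact/measurable_EFinP/measurable_funTS.
rewrite -[RHS](@ge0_integral_distribution _ _ _ _ _ P X')//.
pose g := Radon_Nikodym_SigmaFinite.f (distribution P X') (@lebesgue_measure R).
have ig : (@lebesgue_measure R).-integrable setT g.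
  exact: Radon_Nikodym_SigmaFinite.f_integrable.
have mg : measurable_fun setT g := measurable_int _ ig.
have mEf : measurable_fun setT (EFin \o f) by exact/measurable_EFinP.
rewrite -(Radon_Nikodym_SigmaFinite.change_of_variables X'leb)//.
apply: ae_eq_integral => //; [exact: emeasurable_funM..|].
apply: ae_eqe_mul2l; apply: integral_ae_eq => //.
- apply/integrableP; split => //.
  under eq_integral do rewrite gee0_abs ?lee_fin//=.
  by have := X'E _ measurableT; rewrite probability_setT => <-; exact: ltry.
- by move=> A _ mA; rewrite -X'E// -Radon_Nikodym_SigmaFinite.f_integral.
Qed.

End density.

(** * The expected shortfall E[(x - X)^+] and its slopes *)

Section shortfall.
Context {R : realType} {d : measure_display} {T : measurableType d}.
Context {P : probability T R} {X : {RV P >-> R}} {f : R -> R} {Xbar : R}.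
Hypothesis X_bounded : forall t, 0 <= X t <= Xbar.
Hypothesis Xf : has_density X f.

Local Notation prob_le x := (fine (cdf X x)).
Local Notation shortfall x := (fine ('E_P[fun t => (Num.max (x - X t) 0)%R])%E).

Lemma bounded_Lfun1 (Y : T -> R) (M : R) :
  measurable_fun setT Y -> (forall t, `|Y t| <= M) -> Y \in Lfun P 1.
Proof.
move=> mY YM; apply/Lfun1_integrable.
apply: measurable_bounded_integrable => //.
  exact: le_lt_trans (probability_le1 P measurableT) (ltry 1).
exists M; split; first exact: num_real.
by move=> r Mr t _ /=; exact: le_trans (YM t) (ltW Mr).
Qed.

Lemma measurable_shortfall x :
  measurable_fun setT (fun t => Num.max (x - X t) 0).
Proof. by apply: measurable_maxr => //; exact: measurable_funB. Qed.

Lemma shortfall_Lfun1 x : (fun t => Num.max (x - X t) 0) \in Lfun P 1.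
Proof.
apply: (@bounded_Lfun1 _ `|x|); first exact: measurable_shortfall.
move=> t; have /andP[X0 _] := X_bounded t.
rewrite ger0_norm ?le_max ?lexx ?orbT// ge_max normr_ge0.
by rewrite (le_trans _ (ler_norm x))//; lra.
Qed.

Lemma le_event_measurable x : measurable (X @^-1` `]-oo, x]).
Proof. exact: measurable_funPTI. Qed.

Lemma indic_Lfun1 (k x : R) : (k \o* \1_(X @^-1` `]-oo, x])) \in Lfun P 1.
Proof.
apply: (@bounded_Lfun1 _ `|k|).
  by apply: measurable_funM => //; exact/measurable_indic/le_event_measurable.
by move=> t /=; rewrite normrM indicE; case: (_ \in _);
  rewrite /= ?normr1 ?normr0 ?mulr1 ?mulr0 ?mul1r ?mul0r.
Qed.

Lemma expectation_le_event (k x : R) :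
  ('E_P[k \o* \1_(X @^-1` `]-oo, x])] = (k * prob_le x)%:E)%E.
Proof.
rewrite expectationZl; last first.
  rewrite (_ : \1_ _ = 1 \o* \1_(X @^-1` `]-oo, x])) ?indic_Lfun1//.
  by apply/funext => t /=; rewrite mulr1.
rewrite expectation_indic; last exact: le_event_measurable.
by rewrite EFinM fineK// fin_num_measure.
Qed.

Lemma le_event_indic x t :
  \1_(X @^-1` `]-oo, x]) t = if X t <= x then 1 else 0 :> R.
Proof.
rewrite indicE; case: ifPn => h; first by rewrite mem_set//= in_itv.
by rewrite memNset//= in_itv/=; exact/negP.
Qed.

Lemma expectation_le_Lfun1 (Y Z : T -> R) : Y \in Lfun P 1 -> Z \in Lfun P 1 ->
  (forall t, Y t <= Z t) -> fine ('E_P[Y])%E <= fine ('E_P[Z])%E.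
Proof.
move=> LY LZ YZ; apply: fine_le; [exact: expectation_fin_num..|].
rewrite unlock; apply: le_integral => //; [exact/Lfun1_integrable..|].
by move=> t _; rewrite lee_fin.
Qed.

Lemma expectationD_fine (Y Z : T -> R) : Y \in Lfun P 1 -> Z \in Lfun P 1 ->
  fine ('E_P[Y \+ Z])%E = fine ('E_P[Y])%E + fine ('E_P[Z])%E.
Proof.
by move=> LY LZ; rewrite expectationD// fineD//; exact: expectation_fin_num.
Qed.

(** Expectation of the pointwise bound (y - x) 1{X <= x} <= (y - X)^+ - (x - X)^+. With the upper
    bound that follows, it encloses the slopes of the shortfall between values of the CDF, which
    takes the place of differentiation. *)
Lemma shortfall_slope_ge x y : x <= y ->
  (y - x) * prob_le x <= shortfall y - shortfall x.
Proof.
move=> xy; have ex := expectation_le_event (y - x) x.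
rewrite -[leLHS]/(fine (_%:E)) -ex lerBrDl.
rewrite -expectationD_fine; [|exact: shortfall_Lfun1|exact: indic_Lfun1].
apply: expectation_le_Lfun1; last first.
- move=> t /=; rewrite le_event_indic.
  by case: ifPn; rewrite -?ltNge => h; rewrite le_max ?mul1r ?mul0r;
    case: (lerP (x - X t) 0) => ?; lra.
- exact: shortfall_Lfun1.
- by apply: rpredD; [exact: shortfall_Lfun1|exact: indic_Lfun1].
Qed.

(** The pointwise bound is now (y - X)^+ - (x - X)^+ <= (y - x) 1{X <= y}. *)
Lemma shortfall_slope_le x y : x <= y ->
  shortfall y - shortfall x <= (y - x) * prob_le y.
Proof.
move=> xy; have ey := expectation_le_event (y - x) y.
rewrite -[leRHS]/(fine (_%:E)) -ey lerBlDl.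
rewrite -expectationD_fine; [|exact: shortfall_Lfun1|exact: indic_Lfun1].
apply: expectation_le_Lfun1; first exact: shortfall_Lfun1.
  by apply: rpredD; [exact: shortfall_Lfun1|exact: indic_Lfun1].
move=> t /=; rewrite le_event_indic.
by case: ifPn; rewrite -?ltNge => h; rewrite ge_max ?mul1r ?mul0r;
  case: (lerP (x - X t) 0) => ?; lra.
Qed.

(** Since X >= 0, the event X <= x lies in X = 0, which is null because the law has a density. *)
Lemma cdf_nonpos x : x <= 0 -> cdf X x = 0%E.
Proof.
move=> x0; apply/eqP; rewrite eq_le cdf_ge0 andbT.
rewrite -(density_set1 Xf 0) /cdf /distribution /pushforward.
apply: le_measure; rewrite ?inE; [exact: measurable_funPTI..|].
by move=> t /=; rewrite in_itv/= => Xx; have /andP[X0 _] := X_bounded t; lra.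
Qed.

Lemma shortfall0 : shortfall 0 = 0.
Proof.
rewrite (_ : (fun _ => _) = cst 0) ?expectation_cst//.
apply/funext => t; have /andP[X0 _] := X_bounded t; apply/max_idPr; lra.
Qed.

(** A nonnegative variable of mean zero vanishes almost surely; but X = 0 is a null event, so the
    whole space would be null. *)
Lemma mean_gt0 : 0 < fine ('E_P[X])%E.
Proof.
have X0 t : 0 <= X t by case/andP: (X_bounded t).
have LX : (X : T -> R) \in Lfun P 1.
  apply: (@bounded_Lfun1 _ Xbar) => // t.
  by rewrite ger0_norm//; case/andP: (X_bounded t).
have E0 : (0 <= 'E_P[X])%E by exact: expectation_ge0.
rewrite lt_neqAle fine_ge0// andbT; apply/eqP => EX.
have {}EX : (\int[P]_t `|(X t)%:E| = 0)%E.
  under eq_integral do rewrite gee0_abs ?lee_fin//.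
  by rewrite -expectation_def -(fineK (expectation_fin_num LX)) -EX.
have X0_ae : {ae P, forall t, setT t -> (X t)%:E = 0%E}.
  by apply/ae_eq_integral_abs => //; exact/measurable_EFinP.
have : P.-negligible setT.
  apply: (@negligibleS _ _ _ _
    ([set t | ~ (setT t -> (X t)%:E = 0%E)] `|` [set t | X t = 0])).
    move=> t _; have [Xt|Xt] := eqVneq (X t) 0; first by right.
    by left => /= /(_ I)[] /eqP; rewrite (negbTE Xt).
  apply: negligibleU => //; apply/negligibleP.
    exact: (measurable_funPTI X (measurable_set1 _)).
  exact: (density_set1 Xf 0).
move/negligibleP => /(_ measurableT) P0.
by have /eqP := probability_setT P; rewrite P0 eqe eq_sym oner_eq0.
Qed.

(** Both sides are E[X; X <= x]: pointwise, x 1{X <= x} - (x - X)^+ = X 1{X <= x}, and X >= 0 turns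
    the event X <= x into X in [0, x]. *)
Lemma cdf_sub_shortfall x : 0 <= x ->
  x * prob_le x - shortfall x =
  \int[lebesgue_measure]_(u in `[0, x]) (u * f u).
Proof.
move=> x0; have X0 t : 0 <= X t by case/andP: (X_bounded t).
have mE : measurable `[0, x]%classic by exact: measurable_itv.
pose h : R -> R := id \_ `[0, x].
have hE u : h u = if 0 <= u <= x then u else 0.
  by rewrite /h patchE mem_setE in_itv.
pose hX t : R := (if X t <= x then X t else 0).
have hXE : hX = (x \o* \1_(X @^-1` `]-oo, x])) \-
    (fun t => Num.max (x - X t) 0).
  apply/funext => t; rewrite /= le_event_indic /hX.
  by case: ifPn; rewrite -?ltNge => h'; case: (lerP (x - X t) 0) => ?; lra.
have LX : hX \in Lfun P 1.
  by rewrite hXE; apply: rpredB; [exact: indic_Lfun1|exact: shortfall_Lfun1].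
have -> : x * prob_le x - shortfall x = fine ('E_P[hX])%E.
  rewrite -[X in X - _]/(fine (_%:E)) -expectation_le_event.
  apply/eqP; rewrite subr_eq -expectationD_fine//; last exact: shortfall_Lfun1.
  apply/eqP; congr (fine _); congr (expectation _ _).
  by apply/funext => t /=; rewrite hXE /= subrK.
rewrite /Rintegral; congr (fine _).
rewrite integral_mkcond.
under eq_integral => u _.
  rewrite (_ : _ u = (h u)%:E * (f u)%:E)%E; last first.
    by rewrite patchE mem_setE in_itv/= hE; case: ifP => //; rewrite mul0e.
  over.
rewrite (density_change_of_variables Xf) => [|u|]; last 2 first.
- by rewrite lee_fin hE; case: ifP => // /andP[].
- by apply/measurable_EFinP/measurable_restrict => //; rewrite setTI.
by rewrite unlock; apply: eq_integral => t _; rewrite hE X0.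
Qed.

End shortfall.

(** * Indexing of the two suppliers and unilateral price changes *)

Lemma otherK i : other (other i) = i.
Proof. exact: rev_ordK. Qed.

Lemma other_neq i : (other i == i) = false.
Proof. by case: i => [[|[|[]]]]. Qed.

Lemma eq_other i j : j != i -> j = other i.
Proof.
by case: i j => [[|[|i]] hi] [[|[|j]] hj] //= ij; apply/val_inj => //=.
Qed.

Lemma sum_other (V : nmodType) (G : 'I_2 -> V) i :
  \sum_(k < 2) G k = G i + G (other i).
Proof.
rewrite (bigD1 i)//= (bigD1 (other i)) ?other_neq//= big1 ?addr0// => j.
by case/andP=> /eq_other -> /eqP.
Qed.

Section prices.
Context {R : realType}.
Implicit Types (p : 'I_2 -> R) (i : 'I_2) (q : R).

Lemma deviate_self p i q : deviate p i q i = q.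
Proof. by rewrite /deviate eqxx. Qed.

Lemma deviate_other p i q : deviate p i q (other i) = p (other i).
Proof. by rewrite /deviate other_neq. Qed.

Lemma convex_le (a u v w : R) : 0 <= a <= 1 -> u <= w -> v <= w ->
  a * u + (1 - a) * v <= w.
Proof. nra. Qed.

End prices.

(** * Bids, and revenue as a function of the quantity sold at a given price *)

Section market.
Context {R : realType} {d : measure_display} {T : measurableType d}.
Context {P : probability T R} {D pbar lambda : R}.
Context {X : 'I_2 -> {RV P >-> R}} {Xbar : 'I_2 -> R}.
Context {f Finv : 'I_2 -> R -> R} {phi : 'I_2 -> bool}.
Hypotheses (D_gt0 : 0 < D) (pbar_gt0 : 0 < pbar) (pbar_lt : pbar < lambda).
Hypothesis X_bounded : forall i t, 0 <= X i t <= Xbar i.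
Hypothesis f_density : forall i, has_density (X i) (f i).
Hypothesis F_inverse : forall i, is_inverse_cdf (X i) (Finv i).
Implicit Types (p y : 'I_2 -> R) (i k : 'I_2) (q x : R).

Local Notation S := (sale_revenue lambda X phi).
Local Notation quantity i q := (bid_quantity lambda X Finv phi (fun=> q) i).
Local Notation total q := (\sum_(i < 2) quantity i q).
Local Notation U := (subgame_revenue D lambda X Finv phi).
Local Notation prob p y i := (prob_first D lambda X phi p y i).
Local Notation equilibrium := (pure_price_equilibrium D pbar lambda X Finv phi).

Let lambda_gt0 : 0 < lambda. Proof. exact: lt_trans pbar_lt. Qed.

(** The penalty does not depend on the price and cancels. *)
Lemma sale_revenueB i q q' x : S i q' x - S i q x = (q' - q) * x.
Proof. by rewrite /sale_revenue; case: ifP => _; ring. Qed.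

Lemma mean_pos i : 0 < mean X i.
Proof. exact: mean_gt0 (X_bounded i) (f_density i). Qed.

Lemma sale_revenue0 i q : S i q 0 = 0.
Proof.
rewrite /sale_revenue; case: ifP => _.
  by rewrite max_r ?mulr0 ?subr0// sub0r oppr_le0 ltW ?mean_pos.
by rewrite (shortfall0 (X_bounded i)) !mulr0 subr0.
Qed.

Lemma sale_revenue_price0 i x : S i 0 x <= 0.
Proof.
rewrite /sale_revenue; case: ifP => _; rewrite mul0r sub0r oppr_le0.
  by rewrite mulr_ge0 ?(ltW lambda_gt0)// le_max lexx orbT.
rewrite mulr_ge0 ?(ltW lambda_gt0)// fine_ge0// expectation_ge0// => t.
by rewrite le_max lexx orbT.
Qed.

Lemma sale_revenue_mean i q x : phi i -> x <= mean X i -> S i q x = q * x.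
Proof.
by move=> pi xm; rewrite /sale_revenue pi max_r ?mulr0 ?subr0// subr_le0.
Qed.

Let level_in01 q : 0 < q <= pbar -> 0 < q / lambda < 1.
Proof.
case/andP=> q0 qp; rewrite divr_gt0//= ltr_pdivrMr// mul1r.
exact: le_lt_trans pbar_lt.
Qed.

(** First-order condition of a supplier without storage: his marginal revenue q - lambda F vanishes
    at his bid. *)
Lemma cdf_quantity i q : ~~ phi i -> 0 < q <= pbar ->
  lambda * fine (cdf (X i) (quantity i q)) = q.
Proof.
move=> /negbTE npi /level_in01 q01; rewrite /bid_quantity npi.
have [_ /(_ _ (Finv i (q / lambda)) q01)[_ ->//]] := F_inverse i.
by rewrite /= mulrC divfK// gt_eqF.
Qed.

(** Monotonicity of the CDF gives the weak inequality; equality would make x a second point of level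
    q / lambda, against the uniqueness in [is_inverse_cdf]. *)
Lemma cdf_lt_quantity i q x : ~~ phi i -> 0 < q <= pbar -> x < quantity i q ->
  lambda * fine (cdf (X i) x) < q.
Proof.
move=> npi q0 xq; have q01 := level_in01 q0.
have cdf_fin z : cdf (X i) z \is a fin_num by exact: fin_num_measure.
rewrite -[ltRHS](cdf_quantity npi q0) ltr_pM2l// lt_neqAle; apply/andP; split.
  apply/eqP => eqF.
  suff xE : x = quantity i q by rewrite xE ltxx in xq.
  rewrite /bid_quantity (negbTE npi); have [_ inv] := F_inverse i.
  apply/(inv _ _ q01).
  rewrite -[LHS](fineK (cdf_fin x)) eqF; congr EFin.
  apply/(mulfI (lt0r_neq0 lambda_gt0)); rewrite cdf_quantity//.
  by rewrite mulrC divfK// gt_eqF.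
by apply: fine_le => //; exact/cdf_nondecreasing/ltW.
Qed.

Lemma quantity_gt0 i q : 0 < q <= pbar -> 0 < quantity i q.
Proof.
move=> q0; have [pi|npi] := boolP (phi i).
  by rewrite /bid_quantity pi mean_pos.
rewrite ltNge; apply/negP => le0; have := cdf_quantity npi q0.
rewrite (cdf_nonpos (X_bounded i) (f_density i) le0) mulr0 => q0'.
by rewrite -q0' ltxx in q0.
Qed.

Lemma quantity0 i : ~~ phi i -> quantity i 0 = 0.
Proof.
by move=> /negbTE npi; rewrite /bid_quantity npi mul0r; case: (F_inverse i).
Qed.

Lemma quantity_ge0 i q : 0 <= q <= pbar -> 0 <= quantity i q.
Proof.
case/andP; rewrite le_eqVlt => /orP[/eqP<- _|q0 qp]; last first.
  by rewrite ltW// quantity_gt0// q0.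
have [pi|npi] := boolP (phi i); last by rewrite quantity0.
by rewrite /bid_quantity pi ltW ?mean_pos.
Qed.

Lemma sale_revenue_increasing i q x x' : 0 < q <= pbar ->
  x < x' -> x' <= quantity i q -> S i q x < S i q x'.
Proof.
move=> q0 xx' x'q; have [pi|npi] := boolP (phi i).
  move: x'q; rewrite /bid_quantity pi => x'm.
  rewrite !sale_revenue_mean//; last exact/ltW/(lt_le_trans xx').
  by rewrite ltr_pM2l//; case/andP: q0.
rewrite /sale_revenue (negbTE npi).
set s := fun z => fine ('E_P[fun t => (Num.max (z - X i t) 0)%R])%E.
rewrite -/(s x) -/(s x').
(* If x' is the bid itself, the slope bound over [x, x'] uses lambda F(x') = q and gives only a weak
   inequality. Splitting at the midpoint restores strictness: lambda F(z) < q on the left half,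
   lambda F(x') <= q on the right half. *)
pose z := (x + x') / 2.
have xz : x < z by rewrite /z; lra.
have zx' : z < x' by rewrite /z; lra.
have := shortfall_slope_le (X_bounded i) (ltW xz).
have := shortfall_slope_le (X_bounded i) (ltW zx').
rewrite -/(s x) -/(s z) -/(s x').
have Fz := cdf_lt_quantity npi q0 (lt_le_trans zx' x'q).
have : lambda * fine (cdf (X i) x') <= q.
  move: x'q; rewrite le_eqVlt => /predU1P[->|x'q].
    by rewrite (cdf_quantity npi q0).
  exact/ltW/cdf_lt_quantity.
move: Fz lambda_gt0 xz zx'.
move: (fine _) (fine _) (s x) (s x') (s z) => Fz Fx' sx sx' sz.
move=> Fz_lt l0 xz zx' Fx'_le h1 h2.
have : lambda * (sx' - sz) <= (x' - z) * q by nra.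
have : lambda * (sz - sx) < (z - x) * q by nra.
nra.
Qed.

Lemma sale_revenue_nondecreasing i q x x' : 0 < q <= pbar ->
  x <= x' -> x' <= quantity i q -> S i q x <= S i q x'.
Proof.
move=> q0; rewrite le_eqVlt => /predU1P[->//|xx' x'q].
exact/ltW/sale_revenue_increasing.
Qed.

(** Below the bid revenue increases. Beyond it, the slope is q - lambda < 0 with storage, and at
    most q - lambda F(bid) = 0 without. At price 0 no sale earns a positive revenue and the bid
    earns 0. *)
Lemma sale_revenue_max i q x : 0 <= q <= pbar ->
  S i q x <= S i q (quantity i q).
Proof.
case/andP; rewrite le_eqVlt => /predU1P[<- _|q0 qp].
  have [pi|npi] := boolP (phi i).
    rewrite /bid_quantity pi [leRHS]sale_revenue_mean// mul0r.
    exact: sale_revenue_price0.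
  by rewrite quantity0// sale_revenue0 sale_revenue_price0.
have q0p : 0 < q <= pbar by rewrite q0.
have [xq|qx] := leP x (quantity i q).
  exact: sale_revenue_nondecreasing.
have [pi|npi] := boolP (phi i).
  move: qx; rewrite /bid_quantity pi => mx.
  rewrite [leRHS]sale_revenue_mean// /sale_revenue pi max_l; last by lra.
  have : 0 <= (lambda - q) * (x - mean X i).
    by rewrite mulr_ge0 // subr_ge0 ltW // (le_lt_trans qp).
  by lra.
have Fy := cdf_quantity npi q0p.
rewrite /sale_revenue (negbTE npi).
have := shortfall_slope_ge (X_bounded i) (ltW qx); move: Fy lambda_gt0.
move: (fine _) (fine _) (fine _) => a b c; nra.
Qed.

(* Only optimality of the bids at their prices is used: revenue at a fixed
   quantity x has slope x in the price. *)
Lemma quantity_nondecreasing i q q' : 0 < q -> q <= q' -> q' <= pbar ->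
  quantity i q <= quantity i q'.
Proof.
move=> q0; rewrite le_eqVlt => /predU1P[->//|qq' q'p].
rewrite leNgt; apply/negP => y'y.
have q0p : 0 < q <= pbar by lra.
have q0p' : 0 <= q' <= pbar by lra.
have := sale_revenue_increasing q0p y'y (lexx _).
have := @sale_revenue_max i q' (quantity i q) q0p'.
have := sale_revenueB i q q' (quantity i q).
have := sale_revenueB i q q' (quantity i q').
move: y'y; move: (quantity i q) (quantity i q') => y y'; nra.
Qed.

(** * Revenue of the supplier served first *)

Local Notation first_sale i q := (Num.min D (quantity i q)).

Lemma first_sale_gt0 i q : 0 < q <= pbar -> 0 < first_sale i q.
Proof. by move=> q0; rewrite lt_min D_gt0 quantity_gt0. Qed.

Lemma sale_revenue_le_first i q x : 0 < q <= pbar -> x <= D ->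
  S i q x <= S i q (first_sale i q).
Proof.
move=> q0 xD; have [yD|Dy] := leP (quantity i q) D.
  by apply: sale_revenue_max; lra.
by apply: sale_revenue_nondecreasing => //; exact: ltW.
Qed.

Lemma sale_revenue_gt0 i q x : 0 < q <= pbar -> 0 < x -> x <= quantity i q ->
  0 < S i q x.
Proof.
by move=> q0 x0 xy; rewrite -(sale_revenue0 i q) sale_revenue_increasing.
Qed.

(** Raise the price at fixed sales, a strict gain if sales are positive; then adjust sales to the
    optimum at the new price. Zero sales at q, possible at price 0, are treated apart: the revenue
    goes from 0 to a positive value. *)
Lemma first_revenue_increasing i q q' : 0 <= q -> q < q' -> q' <= pbar ->
  S i q (first_sale i q) < S i q' (first_sale i q').
Proof.
move=> q0 qq' q'p; have q'0 : 0 < q' <= pbar by lra.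
have : 0 <= first_sale i q by rewrite le_min ltW//= quantity_ge0//; lra.
rewrite le_eqVlt => /predU1P[<-|x0].
  by rewrite sale_revenue0 sale_revenue_gt0 ?first_sale_gt0// ge_min lexx orbT.
apply: (@lt_le_trans _ _ (S i q' (first_sale i q))).
  by rewrite -subr_gt0 sale_revenueB mulr_gt0// subr_gt0.
by rewrite sale_revenue_le_first// ge_min lexx.
Qed.

(** * Revenue in the subgame under the allocation rule *)

Lemma prob_first_other p y i : prob p y (other i) = 1 - prob p y i.
Proof.
rewrite /prob_first otherK; case: ltgtP => _; rewrite ?subrr ?subr0//.
by case: ltgtP => _; rewrite ?subrr ?subr0//; field.
Qed.

Lemma prob_first_in01 p y i : 0 <= prob p y i <= 1.
Proof. by rewrite /prob_first; do ![case: ifP => _]; lra. Qed.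

(** The form as a convex combination of being served first and second: a bound on both terms bounds
    the revenue however a tie is broken. *)
Lemma revenue_mix p y i : revenue D lambda X phi p y i =
  prob p y i * S i (p i) (Num.min D (y i)) +
  (1 - prob p y i) *
    S i (p i) (Num.min (D - Num.min D (y (other i))) (y i)).
Proof.
rewrite /revenue (sum_other _ i) prob_first_other /alloc eqxx.
by rewrite eq_sym other_neq.
Qed.

Lemma subgame_revenue_lower p i : p i < p (other i) ->
  U p i = S i (p i) (first_sale i (p i)).
Proof.
move=> lt; rewrite /subgame_revenue revenue_mix /prob_first lt.
by rewrite mul1r subrr mul0r addr0.
Qed.

Lemma subgame_revenue_higher p i : p (other i) < p i ->
  U p i = S i (p i) (Num.min (D - first_sale (other i) (p (other i)))
                             (quantity i (p i))).
Proof.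
move=> gt; rewrite /subgame_revenue revenue_mix /prob_first gt ltNge ltW//=.
by rewrite mul0r subr0 mul1r add0r.
Qed.

(** * Profitable deviations and non-existence of equilibria *)

Lemma profitable_deviation p i q : 0 <= q <= pbar ->
  U p i < U (deviate p i q) i -> ~ equilibrium p.
Proof. by move=> q0 lt [_ /(_ i q q0)]; rewrite leNgt lt. Qed.

Lemma equilibrium_same_price p : equilibrium p -> forall i, p i = p 0.
Proof.
move=> eqp i; have [p_in _] := eqp.
have ge j : p (other j) <= p j.
  (* The midpoint of the two prices raises the lower one while [j] remains the cheaper supplier. *)
  rewrite leNgt; apply/negP => lt; pose q := (p j + p (other j)) / 2.
  have /andP[pj0 _] := p_in j; have /andP[_ po] := p_in (other j).
  apply: (@profitable_deviation p j q) eqp; first by rewrite /q; lra.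
  have dlt : deviate p j q j < deviate p j q (other j).
    by rewrite deviate_self deviate_other /q; lra.
  rewrite (subgame_revenue_lower lt) (subgame_revenue_lower dlt) deviate_self.
  by apply: first_revenue_increasing => //; rewrite /q; lra.
have [->//|/eq_other ->] := eqVneq i 0.
by apply/eqP; rewrite eq_le ge /=; have := ge (other 0); rewrite otherK.
Qed.

(** The rival of [j] deviates to the cap: though served second, he sells a positive part of the
    demand that [j] leaves, instead of earning at most 0. *)
Lemma no_equilibrium_at0 p j : (forall i, p i = 0) -> quantity j 0 < D ->
  ~ equilibrium p.
Proof.
move=> p0 yjD; apply: (@profitable_deviation p (other j) pbar).
  by rewrite lexx ltW.
apply: (@le_lt_trans _ _ 0).
  rewrite /subgame_revenue revenue_mix !p0.
  apply: convex_le; [exact: prob_first_in01|exact: sale_revenue_price0..].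
have pb : 0 < pbar <= pbar by rewrite pbar_gt0 lexx.
rewrite subgame_revenue_higher deviate_self deviate_other otherK p0//.
apply: sale_revenue_gt0 => //; last by rewrite ge_min lexx orbT.
by rewrite lt_min quantity_gt0// andbT subr_gt0 gt_min yjD orbT.
Qed.

Lemma subgame_revenue_all_sold p q i : (forall j, p j = q) -> 0 <= q <= pbar ->
  total q <= D -> U p i = S i q (quantity i q).
Proof.
move=> pq q0; rewrite (sum_other _ i) => yD.
have yi := quantity_ge0 i q0; have yo := quantity_ge0 (other i) q0.
have bidE j : bid_quantity lambda X Finv phi p j = quantity j q.
  by rewrite /bid_quantity pq.
rewrite /subgame_revenue revenue_mix !bidE !pq.
rewrite (min_r (_ : quantity i q <= D)); last by lra.
rewrite (min_r (_ : quantity (other i) q <= D)); last by lra.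
by rewrite min_r; [ring|lra].
Qed.

(** A deviator to the cap is served second but sells at least as much as before: the other bid
    leaves at least his old bid as residual demand, and his own bid does not shrink. *)
Lemma no_equilibrium_all_sold p q : (forall i, p i = q) -> 0 < q < pbar ->
  total q <= D -> ~ equilibrium p.
Proof.
move=> pq q0p yD; apply: (@profitable_deviation p 0 pbar).
  by rewrite lexx ltW.
have q0 : 0 < q <= pbar by lra.
have q1 : 0 <= q <= pbar by lra.
have pb : 0 < pbar <= pbar by lra.
rewrite (subgame_revenue_all_sold _ pq)//.
rewrite subgame_revenue_higher deviate_self deviate_other pq; last by lra.
apply: (@lt_le_trans _ _ (S 0 pbar (quantity 0 q))).
  by rewrite -subr_gt0 sale_revenueB mulr_gt0 ?quantity_gt0//; lra.
apply: sale_revenue_nondecreasing => //; last by rewrite ge_min lexx orbT.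
rewrite le_min quantity_nondecreasing; [|lra..].
rewrite andbT lerBrDr (le_trans _ yD)// (sum_other _ 0) lerD2l.
by rewrite ge_min lexx orbT.
Qed.

(* The revenue after the undercut is bounded below at the quantity sold before
   it, so that no continuity of the bid in the price is needed. *)
Lemma no_equilibrium_rationed p q : (forall i, p i = q) -> 0 < q <= pbar ->
  D < total q -> ~ equilibrium p.
Proof.
move=> pq q0p Dy.
pose y := bid_quantity lambda X Finv phi p.
have yE j : y j = quantity j q by rewrite /y /bid_quantity pq.
(* The two probabilities of being served first sum to 1, so they cannot both be 1. *)
have [i prob_lt1] : exists i, prob p y i < 1.
  have [?|h] := ltP (prob p y 0) 1; first by exists 0.
  by exists (other 0); rewrite prob_first_other; lra.
have yi := quantity_gt0 i q0p; have yo := first_sale_gt0 (other i) q0p.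
set z := Num.min (D - first_sale (other i) q) (quantity i q).
(* Rationing enters here: as D is below the sum of the bids, being served second means selling
   strictly less. *)
have z_lt : z < first_sale i q.
  rewrite /z lt_min !gt_min; apply/andP; split.
    by rewrite ltrBlDr ltrDl yo.
  rewrite ltrBlDr; move: Dy; rewrite (sum_other _ i) => Dy.
  rewrite ltxx orbF; case: (leP D (quantity (other i) q)) => h; lra.
have UE : U p i =
    prob p y i * S i q (first_sale i q) + (1 - prob p y i) * S i q z.
  by rewrite /subgame_revenue revenue_mix -/y !yE pq.
have := @sale_revenue_increasing i _ _ _ q0p z_lt.
rewrite ge_min lexx orbT => /(_ isT) second_lt.
pose gain := S i q (first_sale i q) - U p i.
have gain_gt0 : 0 < gain by rewrite /gain UE; nra.
(* The bound q / 2 keeps the new price positive. The bound gain / (2 D) keeps the loss from the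
   price cut within half of [gain], since at most D is sold. *)
pose e := Num.min (q / 2) (gain / (2 * D)).
have e0 : 0 < e by rewrite lt_min !divr_gt0 ?mulr_gt0//; lra.
have eq2 : e <= q / 2 by rewrite ge_min lexx.
have eD : e * D <= gain / 2.
  have : e <= gain / (2 * D) by rewrite ge_min lexx orbT.
  by rewrite ler_pdivlMr ?mulr_gt0// => h; lra.
have qe0 : 0 < q - e <= pbar by lra.
apply: (@profitable_deviation p i (q - e)); first by lra.
rewrite [ltRHS]subgame_revenue_lower deviate_self ?deviate_other ?pq; last first.
  by lra.
apply: (@lt_le_trans _ _ (S i (q - e) (first_sale i q))); last first.
  by rewrite sale_revenue_le_first// ge_min lexx.
have lossE : S i (q - e) (first_sale i q) =
    S i q (first_sale i q) - e * first_sale i q.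
  have qeq : q - e - q = - e by rewrite addrAC subrr sub0r.
  have := sale_revenueB i q (q - e) (first_sale i q).
  by rewrite qeq mulNr => /(canRL (subrK _)) ->; rewrite addrC.
have loss : e * first_sale i q < gain.
  apply: (@le_lt_trans _ _ (e * D)); first by rewrite ler_pM2l// ge_min lexx.
  by apply: le_lt_trans eD _; rewrite ltr_pdivrMr// ltr_pMr// ltr1n.
have -> : U p i = S i q (first_sale i q) - gain by rewrite /gain subKr.
by rewrite lossE ltrD2l ltrN2.
Qed.

(** An equilibrium has a common price: it is 0, or positive with rationing, or positive with both
    bids sold. In the last case it lies below the cap, where the bids exceed D. The condition on [j]
    excludes price 0 in all subgame types at once. *)
Lemma no_equilibrium j : quantity j 0 < D -> D < total pbar ->
  ~ exists p, equilibrium p.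
Proof.
move=> yjD Dy [p eqp]; have pE := equilibrium_same_price eqp.
have /andP[] := (eqp.1 0); rewrite le_eqVlt => /predU1P[p0|p0 pp].
  by move=> _; apply: (no_equilibrium_at0 _ yjD eqp) => i; rewrite pE -p0.
have [Dp|pD] := ltP D (total (p 0)).
  by apply: (no_equilibrium_rationed pE _ Dp eqp); rewrite p0.
apply: (no_equilibrium_all_sold pE _ pD eqp); rewrite p0 lt_neqAle pp andbT/=.
by apply/eqP => p0E; move: pD; rewrite p0E leNgt Dy.
Qed.

(** * Existence of equilibria and their revenues *)

Lemma equilibrium_pbar : total pbar <= D ->
  equilibrium (fun=> pbar) /\
  forall i, U (fun=> pbar) i = S i pbar (quantity i pbar).
Proof.
move=> yD; have pb : 0 <= pbar <= pbar by rewrite ltW/=.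
have UE i : U (fun=> pbar) i = S i pbar (quantity i pbar).
  exact: subgame_revenue_all_sold.
split => //; split => // i q /andP[q0 qp]; rewrite UE.
(* At fixed sales the cap pays at least as much as q, and at the cap the bid is the best quantity.
   This bounds a deviator's revenue in either order of service. *)
have S_le x : 0 <= x -> S i q x <= S i pbar (quantity i pbar).
  move=> x0; apply: (@le_trans _ _ (S i pbar x)); last exact: sale_revenue_max.
  by rewrite -subr_ge0 sale_revenueB mulr_ge0// subr_ge0.
have bid_ge0 : 0 <= quantity i q by rewrite quantity_ge0 ?q0.
rewrite /subgame_revenue revenue_mix deviate_self.
have -> : bid_quantity lambda X Finv phi (deviate (fun=> pbar) i q) i =
    quantity i q.
  by rewrite /bid_quantity deviate_self.
apply: convex_le; first exact: prob_first_in01.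
  by apply: S_le; rewrite le_min ltW.
by apply: S_le; rewrite le_min bid_ge0 subr_ge0 ge_min lexx.
Qed.

(** A supplier who raises his price is served after a rival who covers the whole demand, and sells
    nothing. At price 0, sales are at most D <= E[X_i] and incur no penalty. *)
Lemma equilibrium_0 : (forall i, phi i) -> (forall i, D <= mean X i) ->
  equilibrium (fun=> 0) /\ forall i, U (fun=> 0) i = 0.
Proof.
move=> pi Dm.
have yE p i : bid_quantity lambda X Finv phi p i = mean X i.
  by rewrite /bid_quantity pi.
have U_price0 p i : p i = 0 -> U p i = 0.
  move=> p0; rewrite /subgame_revenue revenue_mix p0 !yE.
  by rewrite !sale_revenue_mean ?mul0r ?mulr0 ?addr0// ge_min lexx ?orbT.
split; last by move=> i; rewrite U_price0.
split=> [i|i q /andP[]]; first by rewrite lexx ltW.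
rewrite le_eqVlt => /predU1P[<- _|q0 _].
  by rewrite !U_price0// deviate_self.
rewrite [leRHS]U_price0// subgame_revenue_higher deviate_self deviate_other//.
rewrite !yE (min_l (Dm _)) subrr min_l ?sale_revenue0//.
exact/ltW/mean_pos.
Qed.

Lemma uninvested_revenue i : ~~ phi i ->
  S i pbar (quantity i pbar) =
  lambda * \int[lebesgue_measure]_(x in `[0%R, Finv i (pbar / lambda)])
    (x * f i x).
Proof.
move=> npi; have pb : 0 < pbar <= pbar by rewrite pbar_gt0 lexx.
have Fy := cdf_quantity npi pb; have y0 := ltW (quantity_gt0 i pb).
have -> : Finv i (pbar / lambda) = quantity i pbar.
  by rewrite /bid_quantity (negbTE npi).
rewrite -(cdf_sub_shortfall (X_bounded i) (f_density i))//.
(* Replacing the price by lambda F(y) factors lambda out of the revenue. *)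
by rewrite /sale_revenue (negbTE npi) -{1}Fy; ring.
Qed.

End market.

(** * Assembly of the cases *)

Theorem proposition2 (R : realType) (d : measure_display)
    (T : measurableType d) (P : probability T R)
    (D pbar lambda : R)
    (X : 'I_2 -> {RV P >-> R}) (Xbar : 'I_2 -> R)
    (f Finv : 'I_2 -> R -> R) (phi : 'I_2 -> bool)
    (D_gt0 : 0 < D) (pbar_gt0 : 0 < pbar) (pbar_lt : pbar < lambda)
    (X_bounded : forall i t, 0 <= X i t <= Xbar i)
    (F_continuous : forall i, continuous (cdf (X i)))
    (f_density : forall i, has_density (X i) (f i))
    (F_inverse : forall i, is_inverse_cdf (X i) (Finv i)) :
  let ymax := bid_quantity lambda X Finv phi (fun=> pbar) in
  let revenueE := subgame_revenue D lambda X Finv phi in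
  let equilibrium := pure_price_equilibrium D pbar lambda X Finv phi in
  ((\sum_(i < 2) phi i < 2)%N ->
     (\sum_(i < 2) ymax i <= D ->
        equilibrium (fun=> pbar) /\
        forall i, revenueE (fun=> pbar) i =
          if phi i then pbar * mean X i
          else lambda * (\int[lebesgue_measure]_(x in `[0%R, Finv i (pbar / lambda)])
                           (x * f i x))) /\
     (D < \sum_(i < 2) ymax i -> ~ exists p, equilibrium p)) /\
  ((\sum_(i < 2) phi i = 2)%N ->
     (\sum_(i < 2) ymax i <= D ->
        equilibrium (fun=> pbar) /\
        forall i, revenueE (fun=> pbar) i = pbar * mean X i) /\
     (D <= Num.min (ymax 0) (ymax 1) ->
        equilibrium (fun=> 0) /\
        forall i, revenueE (fun=> 0) i = 0) /\
     (Num.min (ymax 0) (ymax 1) < D < \sum_(i < 2) ymax i ->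
        ~ exists p, equilibrium p)).
Proof.
move=> ymax revenueE equilibrium.
have invested_revenue i : phi i ->
    sale_revenue lambda X phi i pbar (ymax i) = pbar * mean X i.
  by move=> pi; rewrite /ymax /bid_quantity pi sale_revenue_mean.
have at_pbar :=
  equilibrium_pbar D_gt0 pbar_gt0 pbar_lt X_bounded f_density F_inverse.
have no_eq :=
  no_equilibrium D_gt0 pbar_gt0 pbar_lt X_bounded f_density F_inverse.
split=> [phi_lt|phi2].
  split=> [yD|Dy].
    have [eq_pbar UE] := at_pbar phi yD; split=> // i; rewrite /revenueE UE; case: ifPn => pi.
      exact: invested_revenue.
    exact: uninvested_revenue.
  (* A supplier without storage bids 0 < D at price 0, by the convention on the inverse CDF at 0. *)
  have [j npj] : exists j, ~~ phi j.
    move: phi_lt; rewrite !big_ord_recl big_ord0.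
    have [_|] := boolP (phi ord0); last by exists ord0.
    have [_|] := boolP (phi (lift ord0 ord0)); last by exists (lift ord0 ord0).
    by [].
  apply: (no_eq phi j) => //.
  by rewrite (quantity0 F_inverse).
have pi i : phi i.
  move: phi2; rewrite (sum_other _ i).
  by case: (phi i) (phi (other i)) => [] [].
have yE q i : bid_quantity lambda X Finv phi (fun=> q) i = mean X i.
  by rewrite /bid_quantity pi.
split; [|split].
- move=> yD; have [eq_pbar UE] := at_pbar phi yD.
  by split=> // i; rewrite /revenueE UE invested_revenue.
- rewrite le_min /ymax !yE => /andP[D0 D1].
  apply: equilibrium_0 => // i.
  have [->//|/eq_other ->] := eqVneq i 0.
  by have -> : other 0 = 1 by apply/val_inj.
(* With storage the bid is the mean at every price, so a bid below D at the cap is also below D at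
   price 0. *)
- case/andP; rewrite gt_min => yD Dy.
  by case/orP: yD => yjD; apply: (no_eq phi _ _ Dy); rewrite yE -(yE pbar);
    exact: yjD.
Qed.
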